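(* Let $A\in\mathbb{R}^{m\times n}$ with $m\ge n$, let $[a,b]\subset[\sigma_{\min},\|A\|]$ with $a<b$, let $P_S$ be the (generalized) spectral projector of $S=A^TA$ associated with the singular values of $A$ in $[a,b]$, and let $P=\psi_d(l(S))$ be its Chebyshev--Jackson approximation of degree $d$. Then $$|\mathrm{tr}(P_S)-\mathrm{tr}(P)|\le n\|P_S-P\|\le\frac{n\pi^6}{2(d+2)^3\Delta_{\min}^4}.$$
   Context: $\|\cdot\|$ is the 2-norm (spectral norm for matrices), $\sigma_{\min}=\sigma_{\min}(A)$ is the smallest of the $n$ singular values of $A$. Let $V$ be an orthogonal matrix of right singular vectors of $A$. The spectral projector is $P_S=V_{in}V_{in}^T+\frac12V_{ab}V_{ab}^T$, where $V_{in}$ consists of the columns of $V$ belonging to eigenvalues of $S$ in the open interval $(a^2,b^2)$ and $V_{ab}$ of the columns belonging to eigenvalues of $S$ equal to $a^2$ or $b^2$. The linear map $l(x)=\frac{2x-\|A\|^2-\sigma_{\min}^2}{\|A\|^2-\sigma_{\min}^2}$ maps $[\sigma_{\min}^2,\|A\|^2]$ onto $[-1,1]$. Put $\alpha=\arccos(l(a^2))$, $\beta=\arccos(l(b^2))$. The Chebyshev--Jackson series of degree $d$ (a positive integer) is $\psi_d(x)=\frac{c_0}{2}+\sum_{j=1}^d\rho_{j,d}c_jT_j(x)$, where $T_j$ is the Chebyshev polynomial of the first kind of degree $j$, $c_0=\frac2\pi(\alpha-\beta)$, $c_j=\frac{2}{\pi}\frac{\sin(j\alpha)-\sin(j\beta)}{j}$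 for $j\ge1$, and $$\rho_{j,d}=\frac{(d+2-j)\sin(\frac{\pi}{d+2})\cos(\frac{j\pi}{d+2})+\cos(\frac{\pi}{d+2})\sin(\frac{j\pi}{d+2})}{(d+2)\sin\frac{\pi}{d+2}}.$$ The approximate projector is $P=\psi_d(l(S))$ (matrix polynomial in $S$). The quantity $\Delta_{\min}$ is $\min\{\Delta_{il},\Delta_{ir},\Delta_{ol},\Delta_{or}\}$ with $\Delta_{il}=|\arccos(l(\sigma_{il}^2))-\alpha|$, $\Delta_{ir}=|\arccos(l(\sigma_{ir}^2))-\beta|$, $\Delta_{ol}=|\arccos(l(\sigma_{ol}^2))-\alpha|$, $\Delta_{or}=|\arccos(l(\sigma_{or}^2))-\beta|$, where $\sigma_{il},\sigma_{ir}$ and $\sigma_{ol},\sigma_{or}$ are the singular values of $A$ closest to the ends $a$ and $b$ from inside and from outside of $[a,b]$, respectively (all four assumed to exist): $\sigma_{il}$ and $\sigma_{ir}$ are the smallest and largest singular values in $(a,b)$, $\sigma_{ol}$ is the largest singular value less than $a$, $\sigma_{or}$ is the smallest singular value greater than $b$. *)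

(* Defs.v *)
From HB Require Import structures.
From mathcomp Require Import all_boot all_order all_algebra.
From mathcomp Require Import boolp classical_sets reals trigo.

Set Implicit Arguments.
Unset Strict Implicit.
Unset Printing Implicit Defensive.

Import Order.TTheory GRing.Theory Num.Theory.
Local Open Scope classical_set_scope.
Local Open Scope ring_scope.

Definition norm2 (R : realType) (n : nat) (x : 'cV[R]_n) : R :=
  Num.sqrt (\sum_i x i 0 ^+ 2).

(* The norm that MathComp-Analysis puts on matrices is the entrywise maximum,
   hence the definition of the spectral norm as an operator norm. *)
Definition spectral_norm (R : realType) (m n : nat) (M : 'M[R]_(m, n)) : R :=
  sup [set norm2 (M *m x) | x in [set x : 'cV[R]_n | norm2 x <= 1]].

(* Thin singular value decomposition of A, for n <= m: V is an orthogonal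
   matrix, its i-th column is a right singular vector for the singular value
   s 0 i, and an eigenvector of A^T A for the eigenvalue (s 0 i)^2.  The
   singular values are repeated with multiplicity and in no given order. *)
Definition is_svd (R : realType) (m n : nat) (A : 'M[R]_(m, n))
    (U : 'M[R]_(m, n)) (s : 'rV[R]_n) (V : 'M[R]_n) : Prop :=
  [/\ U^T *m U = 1%:M, V^T *m V = 1%:M, (forall i, 0 <= s 0 i)
    & A = U *m diag_mx s *m V^T].

Definition is_least (R : realType) (E : set R) (x : R) : Prop :=
  E x /\ lbound E x.

Definition is_greatest (R : realType) (E : set R) (x : R) : Prop :=
  E x /\ ubound E x.

Definition cols_of (R : realType) (n : nat) (V : 'M[R]_n) (I : {set 'I_n}) :
    'M[R]_(n, #|I|) :=
  colsub (fun k : 'I_#|I| => enum_val k) V.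

Definition spectral_projector (R : realType) (n : nat) (s : 'rV[R]_n)
    (V : 'M[R]_n) (a b : R) : 'M[R]_n :=
  let Vin := cols_of V [set i | a ^+ 2 < s 0 i ^+ 2 < b ^+ 2]%SET in
  let Vab := cols_of V
    [set i | (s 0 i ^+ 2 == a ^+ 2) || (s 0 i ^+ 2 == b ^+ 2)]%SET in
  Vin *m Vin^T + 2^-1 *: (Vab *m Vab^T).

(* The map l, as a polynomial of degree one, with N = ||A||. *)
Definition lmap (R : realType) (N smin : R) : {poly R} :=
  (N ^+ 2 - smin ^+ 2)^-1 *: (2 *: 'X - (N ^+ 2 + smin ^+ 2)%:P).

Definition angle (R : realType) (l : {poly R}) (x : R) : R :=
  acos l.[x ^+ 2].

Fixpoint chebyshev (R : realType) (j : nat) : {poly R} :=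
  match j with
  | 0 => 1
  | 1 => 'X
  | (j'.+1 as k).+1 => 2 *: ('X * chebyshev R k) - chebyshev R j'
  end.

Definition cheb_coef (R : realType) (alpha beta : R) (j : nat) : R :=
  if j == 0%N then 2 / pi * (alpha - beta)
  else 2 / pi * ((sin (j%:R * alpha) - sin (j%:R * beta)) / j%:R).

Definition jackson (R : realType) (d j : nat) : R :=
  let t : R := pi / (d + 2)%:R in
  (((d + 2)%:R - j%:R) * sin t * cos (j%:R * t) + cos t * sin (j%:R * t))
    / ((d + 2)%:R * sin t).

Definition cheb_jackson (R : realType) (alpha beta : R) (d : nat) : {poly R} :=
  (cheb_coef alpha beta 0 / 2)%:P
  + \sum_(1 <= j < d.+1)
      (jackson R d j * cheb_coef alpha beta j) *: chebyshev R j.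

Definition approx_projector (R : realType) (n : nat) (S : 'M[R]_n.+1)
    (l : {poly R}) (a b : R) (d : nat) : 'M[R]_n.+1 :=
  horner_mx (horner_mx S l) (cheb_jackson (angle l a) (angle l b) d).

Definition Delta_min (R : realType) (l : {poly R})
    (a b sil sir sol sor : R) : R :=
  Num.min
    (Num.min `|angle l sil - angle l a| `|angle l sir - angle l b|)
    (Num.min `|angle l sol - angle l a| `|angle l sor - angle l b|).

(* Main.v *)
Require Import Defs.
From HB Require Import structures.
From mathcomp Require Import all_boot all_order all_algebra.
From mathcomp Require Import boolp classical_sets reals trigo.
From mathcomp Require Import functions topology derive realfun normedtype.
From mathcomp Require Import ring lra.

(** Everything is diagonal in the basis [V] of right singular vectors: both
    [P_S] and [P] have the form [V *m diag *m V^T], so the trace of their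
    difference is a sum of as many diagonal entries as [A] has columns, its
    spectral norm is the largest absolute value of an entry, and the first
    inequality follows.  The second one becomes a scalar estimate: writing a singular value as the angle
    [t] with [cos t = l(sigma^2)], the entry is the error at [t] of the
    Chebyshev--Jackson approximation of the indicator of [[beta, alpha]], with
    the value 1/2 at both ends.

    For the scalar estimate, let [K(t) = 1/2 + sum_j rho_j cos(j t)] be the
    Jackson kernel and [G] its odd primitive.  Product-to-sum formulas give
      [pi psi_d(cos t) = G(alpha+t) + G(alpha-t) - G(beta+t) - G(beta-t)]
    ([horner_cheb_jackson]), the convolution of [K] with the indicator in
    integrated form.  Up to a factor, [K] is the squared modulus of
    [sum_k sin((k+1) tau) e^(ikt)], [tau = pi/(d+2)], because the [rho_j] are
    the autocorrelations of the sines ([jackson_autocorrelation]); so [K >= 0]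
    ([jackson_kernel_ge0]) and [G] is nondecreasing.  Besides,
    [G(pi) = pi/2] and [G(2pi - x) = pi - G(x)], so that [G] is nearly [pi/2] on
    [[delta, 2pi - delta]] and nearly [-pi/2] on the opposite interval, and the
    four terms add up to nearly [pi] times the indicator.  Monotonicity makes the
    errors of these terms partly cancel: in total they are at most twice the
    tail [pi/2 - G(delta)] ([step_approx]).

    The tail is bounded by Markov's inequality for the weight [(1 - cos t)^2],
    whose integral against [K] is an explicit combination of [rho_1] and
    [rho_2] ([cosine_tail]) of order [1/(d+2)^3] ([jackson_moment_le]).  Since
    [1 - cos x >= 2x^2/pi^2] on [[0, pi]], dividing by the weight at [delta]
    yields the factor [1/delta^4]. *)

Set Implicit Arguments.
Unset Strict Implicit.
Unset Printing Implicit Defensive.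

Import Order.TTheory GRing.Theory Num.Theory.
Import numFieldNormedType.Exports.
Local Open Scope classical_set_scope.
Local Open Scope ring_scope.

(** * Derivatives and elementary trigonometric inequalities *)

Lemma ge0_derive_le (R : realType) (f df : R -> R) (x y : R) :
  (forall t : R, is_derive t 1 f (df t)) ->
  (forall t, x < t < y -> 0 <= df t) -> x <= y -> f x <= f y.
Proof.
move=> fdf df_ge0 xy.
have fc : {within `[x, y]%classic, continuous f}.
  apply: derivable_within_continuous => t _; by case: (fdf t).
apply: (@ger0_derive1_le_cc _ f x y) => //; rewrite ?in_itv/= ?lexx ?xy//.
move=> t; rewrite in_itv/= => /df_ge0.
by rewrite derive1E (_ : 'D_1 f t = df t)//; case: (fdf t).
Qed.

(** The rules for sums, differences and multiples, restated for lambda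
    abstractions so that unification recognizes them. *)
Section RealDerivative.
Variables (R : realType) (f g : R -> R) (df dg k t : R).

Lemma is_derive_addf : is_derive t 1 f df -> is_derive t 1 g dg ->
  is_derive t 1 (fun u => f u + g u) (df + dg).
Proof. exact: is_deriveD. Qed.

Lemma is_derive_subf : is_derive t 1 f df -> is_derive t 1 g dg ->
  is_derive t 1 (fun u => f u - g u) (df - dg).
Proof. exact: is_deriveB. Qed.

Lemma is_derive_mulf : is_derive t 1 f df ->
  is_derive t 1 (fun u => k * f u) (k * df).
Proof. exact: is_deriveZ. Qed.

End RealDerivative.

Lemma is_derive_mull (R : realType) (k t : R) :
  is_derive t 1 (fun u : R => k * u) k.
Proof.
rewrite -[X in is_derive _ _ _ X]mulr1; exact: is_derive_mulf.
Qed.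

Lemma sin_le_id (R : realType) (x : R) : 0 <= x -> sin x <= x.
Proof.
move=> x0.
have df (t : R) : is_derive t 1 (fun t : R => t - sin t) (1 - cos t).
  exact: is_derive_subf.
have H : (0 : R) - sin 0 <= x - sin x.
  by apply: (ge0_derive_le df) => // t _; rewrite subr_ge0 cos_le1.
by move: H; rewrite sin0 subrr subr_ge0.
Qed.

Lemma one_sub_cosE (R : realType) (x : R) : 1 - cos x = 2 * sin (x / 2) ^+ 2.
Proof.
have xE : x = (x / 2) *+ 2 by field.
rewrite [in LHS]xE cos_mulr2n cos2sin2; ring.
Qed.

Lemma one_sub_cos_le (R : realType) (x : R) :
  0 <= x <= pi -> 1 - cos x <= x ^+ 2 / 2.
Proof.
move=> /andP[x0 xpi]; rewrite one_sub_cosE.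
have pi0 := pi_ge0 R.
have s0 : 0 <= sin (x / 2) by apply: sin_ge0_pi; lra.
have sl : sin (x / 2) <= x / 2 by apply: sin_le_id; lra.
by nra.
Qed.

(** Jordan's inequality: the difference with the chord vanishes at both ends
    and has a decreasing derivative, so it cannot be negative in between. *)
Lemma sin_ge_chord (R : realType) (y : R) :
  0 <= y <= pi / 2 -> 2 / pi * y <= sin y.
Proof.
have pi0 := pi_gt0 R.
have pin0 : pi != 0 :> R by rewrite gt_eqF.
have E1 : 2 / pi * (pi / 2) = 1 :> R.
  by rewrite mulrA divfK// divff// pnatr_eq0.
move=> /andP[]; rewrite le_eqVlt => /predU1P[<- _|y0].
  by rewrite sin0 mulr0.
rewrite le_eqVlt => /predU1P[->|yp].
  by rewrite E1 sin_pihalf.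
pose c : R := 2 / pi.
pose g (t : R) := sin t - c * t.
have dg (t : R) : is_derive t 1 g (cos t - c).
  by apply: is_derive_subf; exact: is_derive_mull.
have gc u v : {within `[u, v]%classic, continuous g}.
  apply: derivable_within_continuous => t _; by case: (dg t).
rewrite -subr_ge0 leNgt -/c; apply/negP.
rewrite -[sin y - c * y]/(g y) => gy.
have [c1] := MVT y0 (fun t _ => dg t) (gc _ _).
have [c2] := MVT yp (fun t _ => dg t) (gc _ _).
rewrite !in_itv/= => /andP[c2l c2r] D2 /andP[c1l c1r] D1.
have g0 : g 0 = 0 by rewrite /g sin0 mulr0 subr0.
have gp : g (pi / 2) = 0.
  by rewrite /g sin_pihalf /c E1 subrr.
have cl : cos c2 < cos c1.
  rewrite ltr_cos ?in_itv/=; first exact: lt_trans c1r c2l.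
    by apply/andP; split; lra.
  by apply/andP; split; lra.
have n1 : cos c1 - c < 0 by rewrite -(pmulr_llt0 _ y0); lra.
have yp' : 0 < pi / 2 - y by lra.
have n2 : 0 < cos c2 - c by rewrite -(pmulr_lgt0 _ yp'); lra.
lra.
Qed.

Lemma one_sub_cos_ge (R : realType) (x : R) :
  0 <= x <= pi -> 2 * x ^+ 2 / pi ^+ 2 <= 1 - cos x.
Proof.
move=> /andP[x0 xpi]; rewrite one_sub_cosE.
have pi0 := pi_gt0 R.
have /sin_ge_chord : 0 <= x / 2 <= pi / 2 by lra.
have -> : 2 / pi * (x / 2) = x / pi.
  by move: (pi : R) pi0 => p p0; field; rewrite gt_eqF.
have xp : 0 <= x / pi by rewrite divr_ge0// ltW.
move=> sl; rewrite -mulrA -expr_div_n.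
by nra.
Qed.

(** * Primitives of cosine polynomials *)

(** The odd primitive of [t |-> cos (k t)]. *)
Definition primitive_cos {R : realType} (k t : R) : R :=
  if k == 0 then t else sin (k * t) / k.

Lemma is_derive_primitive_cos (R : realType) (k t : R) :
  is_derive t 1 (primitive_cos k) (cos (k * t)).
Proof.
rewrite /primitive_cos; have [->|k0] := eqVneq k 0.
  by rewrite mul0r cos0; exact: is_derive_id.
have ds : is_derive t 1 (fun u : R => sin (k * u)) (k * cos (k * t)).
  rewrite mulrC.
  exact: (@is_derive1_comp _ sin _ _ _ _ (is_derive_sin _) (is_derive_mull k t)).
have -> : (fun u : R => sin (k * u) / k) = fun u => k^-1 * sin (k * u).
  by apply/funext => u; rewrite mulrC.
by have := is_derive_mulf k^-1 ds; rewrite mulKf.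
Qed.

Lemma primitive_cos0 (R : realType) (k : R) : primitive_cos k 0 = 0.
Proof. by rewrite /primitive_cos; case: eqP => //; rewrite mulr0 sin0 mul0r. Qed.

Lemma primitive_cosN (R : realType) (k t : R) :
  primitive_cos k (- t) = - primitive_cos k t.
Proof. by rewrite /primitive_cos; case: eqP => //; rewrite mulrN sinN mulNr. Qed.

Lemma sin_nat_pi (R : realType) (j : nat) : sin (j%:R * pi) = 0 :> R.
Proof.
elim: j => [|j IH]; first by rewrite mul0r sin0.
by rewrite -natr1 mulrDl mul1r sinDpi IH oppr0.
Qed.

Lemma cos_nat_2pi (R : realType) (j : nat) : cos (j%:R * (2 * pi)) = 1 :> R.
Proof.
have -> : j%:R * (2 * pi) = (j%:R * pi) *+ 2 :> R by ring.
by rewrite cos_mulr2n cos2sin2 sin_nat_pi expr0n/= subr0 mulr2n addrK.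
Qed.

Lemma sin_nat_2pi (R : realType) (j : nat) : sin (j%:R * (2 * pi)) = 0 :> R.
Proof. by rewrite mulrA -natrM sin_nat_pi. Qed.

Definition cospoly {R : realType} (n : nat) (w : nat -> R) (t : R) : R :=
  \sum_(j < n) w j * cos (j%:R * t).

Definition cosine_primitive {R : realType} (n : nat) (w : nat -> R) (t : R) : R :=
  \sum_(j < n) w j * primitive_cos j%:R t.

(** The primitive of [(1 - cos t)^2 * cospoly n w t] vanishing at 0, from the
    product formulas for [cos t * cos (j t)] and [cos (2 t) * cos (j t)]. *)
Definition moment_primitive {R : realType} (n : nat) (w : nat -> R) (t : R) : R :=
  \sum_(j < n) w j * (3 / 2 * primitive_cos j%:R t
    - (primitive_cos (j%:R + 1) t + primitive_cos (j%:R - 1) t)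
    + 4^-1 * (primitive_cos (j%:R + 2) t + primitive_cos (j%:R - 2) t)).

Lemma is_derive_sumZ (R : realType) (n : nat) (w : nat -> R)
    (f df : nat -> R -> R) (t : R) :
  (forall j, is_derive t 1 (f j) (df j t)) ->
  is_derive t 1 (fun u => \sum_(j < n) w j * f j u) (\sum_(j < n) w j * df j t).
Proof.
move=> fdf.
have -> : (fun u => \sum_(j < n) w j * f j u) = \sum_(j < n) (fun u => w j * f j u).
  by apply/funext => u; rewrite fct_sumE.
by apply: is_derive_sum => i; exact: is_derive_mulf.
Qed.

Lemma is_derive_cosine_primitive (R : realType) (n : nat) (w : nat -> R) (t : R) :
  is_derive t 1 (cosine_primitive n w) (cospoly n w t).
Proof.
apply: (@is_derive_sumZ R n w (fun j => primitive_cos j%:R) (fun j t => cos (j%:R * t))).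
by move=> j; exact: is_derive_primitive_cos.
Qed.

Lemma is_derive_moment_primitive (R : realType) (n : nat) (w : nat -> R) (t : R) :
  is_derive t 1 (moment_primitive n w) ((1 - cos t) ^+ 2 * cospoly n w t).
Proof.
pose m (j : nat) (u : R) := 3 / 2 * cos (j%:R * u)
    - (cos ((j%:R + 1) * u) + cos ((j%:R - 1) * u))
    + 4^-1 * (cos ((j%:R + 2) * u) + cos ((j%:R - 2) * u)).
have -> : (1 - cos t) ^+ 2 * cospoly n w t = \sum_(j < n) w j * m j t.
  rewrite /cospoly mulr_sumr; apply: eq_bigr => j _.
  rewrite mulrCA; congr (_ * _); rewrite /m.
  rewrite !(mulrDl j%:R _ t) !mulNr mul1r !cosD !cosN !sinN.
  by rewrite [2 * t]mulr_natl cos_mulr2n; field.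
apply: (@is_derive_sumZ R n w (fun j u => 3 / 2 * primitive_cos j%:R u
    - (primitive_cos (j%:R + 1) u + primitive_cos (j%:R - 1) u)
    + 4^-1 * (primitive_cos (j%:R + 2) u + primitive_cos (j%:R - 2) u)) m) => j.
rewrite /m.
apply: is_derive_addf; last first.
  by apply: is_derive_mulf; apply: is_derive_addf; exact: is_derive_primitive_cos.
apply: is_derive_subf.
  by apply: is_derive_mulf; exact: is_derive_primitive_cos.
by apply: is_derive_addf; exact: is_derive_primitive_cos.
Qed.

Lemma cosine_primitive0 (R : realType) (n : nat) (w : nat -> R) :
  cosine_primitive n w 0 = 0.
Proof. by rewrite /cosine_primitive big1// => j _; rewrite primitive_cos0 mulr0. Qed.

Lemma cosine_primitiveN (R : realType) (n : nat) (w : nat -> R) (t : R) :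
  cosine_primitive n w (- t) = - cosine_primitive n w t.
Proof.
by rewrite /cosine_primitive -sumrN; apply: eq_bigr => j _; rewrite primitive_cosN mulrN.
Qed.

Lemma cosine_primitive_reflect (R : realType) (n : nat) (w : nat -> R) (t : R) :
  cosine_primitive n.+1 w (2 * pi - t) = 2 * pi * w 0%N - cosine_primitive n.+1 w t.
Proof.
rewrite /cosine_primitive !big_ord_recl /= /primitive_cos eqxx /= opprD addrA.
rewrite -sumrN; congr (_ + _); first by ring.
apply: eq_bigr => j _; rewrite pnatr_eq0 /=.
by rewrite mulrBr sinB sin_nat_2pi cos_nat_2pi; ring.
Qed.

Lemma cosine_primitive_pi (R : realType) (n : nat) (w : nat -> R) :
  cosine_primitive n.+1 w pi = pi * w 0%N.
Proof.
have := @cosine_primitive_reflect R n w pi.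
by rewrite (_ : 2 * pi - pi = pi) => [|]; [lra|ring].
Qed.

(** Only the terms of frequency 0 contribute to an integral over [[0, pi]];
    they come from [j = 0], [1] and [2]. *)
Lemma moment_primitive_pi (R : realType) (n : nat) (w : nat -> R) :
  moment_primitive n.+3 w pi = pi * (3 / 2 * w 0%N - w 1%N + w 2%N / 4).
Proof.
have piE (k : R) : sin (k * pi) = 0 -> primitive_cos k pi = if k == 0 then pi else 0.
  by rewrite /primitive_cos; case: eqP => // _ ->; rewrite mul0r.
have sD (j i : nat) : sin ((j%:R + i%:R) * pi) = 0 :> R.
  by rewrite -natrD sin_nat_pi.
have sB (j i : nat) : sin ((j%:R - i%:R) * pi) = 0 :> R.
  by rewrite mulrBl sinB !sin_nat_pi mul0r mulr0 subr0.
have cD (j i : nat) : primitive_cos (j%:R + i%:R) pi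
   = if (j + i == 0)%N then pi else 0 :> R.
  by rewrite piE// -natrD pnatr_eq0.
have cB (j i : nat) : primitive_cos (j%:R - i%:R) pi
   = if (j == i)%N then pi else 0 :> R.
  by rewrite piE// subr_eq0 eqr_nat.
have c0 (j : nat) : primitive_cos j%:R pi = if (j == 0)%N then pi else 0 :> R.
  by rewrite piE ?sin_nat_pi// pnatr_eq0.
rewrite /moment_primitive.
under eq_bigr => j _ do rewrite c0 (cD j 1%N) (cB j 1%N) (cD j 2%N) (cB j 2%N).
rewrite 3!big_ord_recl big1 /=; last by move=> j _; rewrite /bump/=; ring.
by rewrite /bump /=; field.
Qed.

Lemma cosine_primitive_homo (R : realType) (n : nat) (w : nat -> R) :
  (forall t, 0 <= cospoly n w t) -> {homo cosine_primitive n w : x y / x <= y}.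
Proof.
by move=> K0 x y; apply: (ge0_derive_le (is_derive_cosine_primitive _ _)).
Qed.

(** Markov's inequality for the density [cospoly] on [[0, pi]]: the weight
    [(1 - cos t)^2] increases there, so the mass of [[x, pi]] times the weight
    at [x] is at most the whole weighted integral. *)
Lemma cosine_tail (R : realType) (n : nat) (w : nat -> R) (x : R) :
  (forall t, 0 <= cospoly n.+3 w t) -> 0 <= x <= pi ->
  (1 - cos x) ^+ 2 * (cosine_primitive n.+3 w pi - cosine_primitive n.+3 w x)
    <= pi * (3 / 2 * w 0%N - w 1%N + w 2%N / 4).
Proof.
move=> K0 /andP[x0 xpi]; rewrite -(moment_primitive_pi n).
set F := moment_primitive n.+3 w.
set G := cosine_primitive n.+3 w; set q := (1 - cos x) ^+ 2.
have F0 : F 0 = 0.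
  by rewrite /F/moment_primitive big1// => j _; rewrite !primitive_cos0; ring.
have F0x : F 0 <= F x.
  apply: (ge0_derive_le (is_derive_moment_primitive _ _)) => // t _.
  by rewrite mulr_ge0// sqr_ge0.
have dF (t : R) : is_derive t 1 (fun t => F t - q * G t)
    ((1 - cos t) ^+ 2 * cospoly n.+3 w t - q * cospoly n.+3 w t).
  apply: is_derive_subf; first exact: is_derive_moment_primitive.
  by apply: is_derive_mulf; exact: is_derive_cosine_primitive.
(* On [[x, pi]] the weight is at least [q], its value at [x], so that
   [F - q * G] is nondecreasing there. *)
have H : F x - q * G x <= F pi - q * G pi.
  apply: (ge0_derive_le dF) => //.
  move=> t /andP[xt tpi]; rewrite -mulrBl mulr_ge0// subr_ge0.
  have : cos t <= cos x.
    by apply/ltW; rewrite ltr_cos ?in_itv/=; lra.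
  have := cos_le1 x; rewrite /q; nra.
by lra.
Qed.

(** * The Jackson kernel is nonnegative *)

(** Expansion of the squared modulus of [sum_k a_k e^(ikt)], grouping the
    products [a_k a_l] by the difference of the indices. *)
Lemma sqr_trig_sum (R : realType) (a : nat -> R) (n : nat) (t : R) :
  (\sum_(0 <= k < n) a k * cos (k%:R * t)) ^+ 2
    + (\sum_(0 <= k < n) a k * sin (k%:R * t)) ^+ 2
  = \sum_(0 <= k < n) a k ^+ 2
    + 2 * \sum_(1 <= j < n)
        (\sum_(0 <= k < n - j) a k * a (k + j)%N) * cos (j%:R * t).
Proof.
elim: n => [|n IH].
  by rewrite !big_geq// expr0n/= mulr0 !addr0.
rewrite !(@big_nat_recr _ _ _ n 0)//=.
set C := \sum_(0 <= k < n) _ in IH *; set S := \sum_(0 <= k < n) _ in IH *.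
set c := cos (n%:R * t); set s := sin (n%:R * t).
(* The new index [n] adds its square and its products with the earlier ones. *)
have -> : (C + a n * c) ^+ 2 + (S + a n * s) ^+ 2
    = C ^+ 2 + S ^+ 2 + a n ^+ 2 * (c ^+ 2 + s ^+ 2)
      + 2 * (a n * (c * C + s * S)) by ring.
rewrite cos2Dsin2 mulr1 {}IH.
have -> : \sum_(1 <= j < n.+1)
      (\sum_(0 <= k < n.+1 - j) a k * a (k + j)%N) * cos (j%:R * t)
    = \sum_(1 <= j < n)
        (\sum_(0 <= k < n - j) a k * a (k + j)%N) * cos (j%:R * t)
      + \sum_(1 <= j < n.+1) a (n - j)%N * a n * cos (j%:R * t).
  (* The term [j = n] may be included, since its inner sum is empty. *)
  have -> : \sum_(1 <= j < n)
        (\sum_(0 <= k < n - j) a k * a (k + j)%N) * cos (j%:R * t)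
      = \sum_(1 <= j < n.+1)
        (\sum_(0 <= k < n - j) a k * a (k + j)%N) * cos (j%:R * t).
    case: n {C S c s} => [|n]; first by rewrite !big_geq.
    by rewrite [RHS]big_nat_recr//= subnn [X in X * _]big_geq// mul0r addr0.
  rewrite -big_split/= !big_nat; apply: eq_bigr => j /andP[j1 jn].
  rewrite ltnS in jn.
  by rewrite subSn// big_nat_recr//= subnK// mulrDl.
suff -> : a n * (c * C + s * S)
    = \sum_(1 <= j < n.+1) a (n - j)%N * a n * cos (j%:R * t) by ring.
rewrite /C /S !mulr_sumr -big_split/= mulr_sumr big_add1/= big_nat_rev/= add0n.
rewrite !big_nat; apply: eq_bigr => k /= kn.
have kn' : (n - k.+1 <= n)%N by rewrite leq_subr.
have -> : (k.+1)%:R * t = n%:R * t - (n - k.+1)%:R * t.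
  by rewrite natrB//; ring.
by rewrite cosB /c /s; ring.
Qed.

(** Twice each product of sines is a difference of cosines; the first does
    not depend on [k], and the sum of the others telescopes once it is multiplied
    by [2 * sin tau]. *)
Lemma sum_sin_shift (R : realType) (tau : R) (j m : nat) :
  4 * sin tau
    * \sum_(0 <= k < m) sin (k.+1%:R * tau) * sin ((k + j).+1%:R * tau)
  = 2 * m%:R * sin tau * cos (j%:R * tau)
    - (sin ((2 * m%:R + 1 + j%:R) * tau) - sin ((1 + j%:R) * tau)).
Proof.
elim: m => [|m IH].
  by rewrite big_geq// mulr0n !mulr0 !mul0r !add0r subrr oppr0.
rewrite big_nat_recr//= mulrDr {}IH.
set x := m.+1%:R * tau; set y := (m + j).+1%:R * tau.
have -> : j%:R * tau = y - x by rewrite /x /y -addSn natrD; ring.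
have -> : (2 * m.+1%:R + 1 + j%:R) * tau = x + y + tau.
  by rewrite /x /y -!natr1 natrD; ring.
have -> : (2 * m%:R + 1 + j%:R) * tau = x + y - tau.
  by rewrite /x /y -!natr1 natrD; ring.
rewrite -natr1 !(sinD, cosD, sinN, cosN); ring.
Qed.

Section Jackson.
Variables (R : realType) (d : nat).

Definition jackson_angle : R := pi / (d + 2)%:R.

Local Notation N := ((d + 2)%:R : R).
Local Notation tau := jackson_angle.

Lemma jackson_sizeN0 : N != 0.
Proof. by rewrite pnatr_eq0 addn2. Qed.

Lemma mul_jackson_angle : N * tau = pi.
Proof. by rewrite /jackson_angle mulrC divfK// jackson_sizeN0. Qed.

Lemma jackson_angle_gt0 : 0 < tau.
Proof. by rewrite divr_gt0// ?pi_gt0// ltr0n addn2. Qed.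

Lemma sin_jackson_angle_gt0 : 0 < sin tau.
Proof.
apply: sin_gt0_pi; rewrite jackson_angle_gt0/=.
rewrite ltr_pdivrMr ?ltr0n ?addn2// ltr_pMr ?pi_gt0// ltr1n//.
Qed.

Lemma jacksonE j : N * sin tau * jackson R d j
  = (N - j%:R) * sin tau * cos (j%:R * tau) + cos tau * sin (j%:R * tau).
Proof.
rewrite /jackson -/tau mulrC divfK// mulf_neq0 ?jackson_sizeN0//.
by rewrite gt_eqF// sin_jackson_angle_gt0.
Qed.

Lemma jackson_eq j (x : R) : N * sin tau * x
  = (N - j%:R) * sin tau * cos (j%:R * tau) + cos tau * sin (j%:R * tau) ->
  jackson R d j = x.
Proof.
rewrite -jacksonE => /esym; apply: mulfI; rewrite mulf_neq0 ?jackson_sizeN0//.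
by rewrite gt_eqF// sin_jackson_angle_gt0.
Qed.

Lemma jackson0 : jackson R d 0 = 1.
Proof. by apply: jackson_eq; rewrite mul0r sin0 cos0; ring. Qed.

Lemma jackson1 : jackson R d 1 = cos tau.
Proof. by apply: jackson_eq; rewrite mul1r; ring. Qed.

Lemma jackson2 : N * (jackson R d 2 - cos (tau *+ 2)) = 2 * sin tau ^+ 2.
Proof.
have := jacksonE 2; rewrite [2 * tau]mulr_natl sin_mulr2n cos_mulr2n => E.
have s0 : sin tau != 0 by rewrite gt_eqF// sin_jackson_angle_gt0.
apply: (mulfI s0).
rewrite mulrA [sin tau * N]mulrC mulrBr E.
by rewrite [in RHS]sin2cos2; ring.
Qed.

(** The coefficient after the last one of the series vanishes.  This makes room
    for a term of index 2 in the kernel even in degree 1. *)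
Lemma jackson_last : jackson R d d.+1 = 0.
Proof.
apply: jackson_eq.
have -> : d.+1%:R * tau = pi - tau.
  by rewrite -mul_jackson_angle addn2 -!natr1; ring.
rewrite sinB cosB sinpi cospi addn2 -!natr1; ring.
Qed.

(** Up to the factor [(d+2)/2], the damping factors of Jackson are the
    autocorrelations of [k |-> sin ((k+1) tau)]: the telescoped sum ends at
    [2 pi - (j+1) tau] and so contributes [2 sin ((j+1) tau)]. *)
Lemma jackson_autocorrelation j : (j <= d.+1)%N ->
  \sum_(0 <= k < d.+1 - j) sin (k.+1%:R * tau) * sin ((k + j).+1%:R * tau)
  = N / 2 * jackson R d j.
Proof.
move=> jd.
have s0 : sin tau != 0 by rewrite gt_eqF// sin_jackson_angle_gt0.
have s4 : 4 * sin tau != 0 by rewrite mulf_neq0// pnatr_eq0.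
apply: (mulfI s4); rewrite sum_sin_shift.
have -> : 4 * sin tau * (N / 2 * jackson R d j) = 2 * (N * sin tau * jackson R d j).
  by field.
rewrite jacksonE.
have -> : (d.+1 - j)%:R = N - 1 - j%:R :> R by rewrite natrB// addn2 -!natr1; ring.
have -> : (2 * (N - 1 - j%:R) + 1 + j%:R) * tau = pi *+ 2 + - ((1 + j%:R) * tau).
  by rewrite -mul_jackson_angle; ring.
rewrite [_ *+ 2 + _]addrC sinD2pi sinN.
by rewrite (mulrDl 1 j%:R tau) mul1r sinD; ring.
Qed.

Definition jackson_weight (j : nat) : R :=
  if j == 0%N then 2^-1 else jackson R d j.

Lemma jackson_kernel_ge0 (t : R) : 0 <= cospoly d.+2 jackson_weight t.
Proof.
have N0 : 0 < N by rewrite ltr0n addn2.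
rewrite -(pmulr_rge0 _ N0).
suff -> : N * cospoly d.+2 jackson_weight t
   = (\sum_(0 <= k < d.+1) sin (k.+1%:R * tau) * cos (k%:R * t)) ^+ 2
    + (\sum_(0 <= k < d.+1) sin (k.+1%:R * tau) * sin (k%:R * t)) ^+ 2.
  by rewrite addr_ge0 ?sqr_ge0.
rewrite sqr_trig_sum.
have := @jackson_autocorrelation 0 (leq0n _); rewrite subn0 jackson0 mulr1.
under eq_bigr => k _ do rewrite addn0 -expr2.
move=> ->.
rewrite /cospoly -(big_mkord xpredT (fun j => jackson_weight j * cos (j%:R * t))).
have w_last : jackson_weight d.+1 = 0 by exact: jackson_last.
rewrite big_ltn// big_nat_recr//= w_last !mul0r addr0.
rewrite [jackson_weight 0]/jackson_weight/= cos0 mulr1 mulrDr; congr (_ + _).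
rewrite !mulr_sumr !big_nat; apply: eq_bigr => j /andP[j1 jd].
rewrite (jackson_autocorrelation (ltnW jd)) /jackson_weight.
by rewrite gtn_eqF//; field.
Qed.

End Jackson.

(** * A moment of the Jackson kernel *)

(** From [cos (3 x) = -1] with [x = pi / 3], that is,
    [(cos x + 1) * (2 cos x - 1)^2 = 0]. *)
Lemma cos_pi_third (R : realType) : cos (pi / 3) = 2^-1 :> R.
Proof.
set x := pi / 3; set c := cos x.
have pi0 := pi_gt0 R.
have s0 : 0 < sin x by apply: sin_gt0_pi; rewrite /x; lra.
have : cos (x *+ 2 + x) = -1.
  by rewrite (_ : x *+ 2 + x = pi) ?cospi// /x; move: (pi : R) => p; field.
rewrite cosD cos_mulr2n sin_mulr2n -/c => E.
have sc : sin x ^+ 2 = 1 - c ^+ 2 by exact: sin2cos2.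
have E2 : (c + 1) * (c - 2^-1) ^+ 2 = 0.
  have : (c ^+ 2 *+ 2 - 1) * c - c * sin x ^+ 2 *+ 2 = -1.
    by apply: etrans E; ring.
  by rewrite sc; move=> E1; lra.
move/eqP: E2; rewrite mulf_eq0 sqrf_eq0 subr_eq0 => /orP[/eqP c1|/eqP//].
by exfalso; nra.
Qed.

(** With [c = cos tau] and [N = d+2], twice the left-hand side equals
    [(1 - c)^2 + (1 - c^2)/N], whose second term is at most [tau^2/N].  For
    [N >= 4] the first is at most [tau^4/4 <= tau^2/N] by the crude bound
    [pi <= 4]; for [N = 3] that bound is too weak, and [c = 1/2] exactly. *)
Lemma jackson_moment_le (R : realType) (d : nat) : (0 < d)%N ->
  3 / 2 * jackson_weight R d 0 - jackson_weight R d 1 + jackson_weight R d 2 / 4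
    <= pi ^+ 2 / (d + 2)%:R ^+ 3.
Proof.
move=> d0; rewrite /jackson_weight/= jackson1.
set N : R := (d + 2)%:R; set tau := jackson_angle R d; set c := cos tau.
have N3 : 3 <= N by rewrite /N ler_nat addn2 !ltnS.
have E2 := jackson2 R d; rewrite -/tau -/N cos_mulr2n sin2cos2 -/c in E2.
have ptau : pi = N * tau by rewrite mul_jackson_angle.
have tau0 : 0 < tau := jackson_angle_gt0 R d.
have taupi : tau <= pi by rewrite ptau; nra.
have s0 := sin_jackson_angle_gt0 R d; rewrite -/tau in s0.
have sle : sin tau <= tau by apply: sin_le_id; exact: ltW.
have s2 : 1 - c ^+ 2 <= tau ^+ 2 by rewrite -sin2cos2; nra.
have cle : 1 - c <= tau ^+ 2 / 2 by apply: one_sub_cos_le; rewrite ltW.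
have c1 : c <= 1 by exact: cos_le1.
rewrite ler_pdivlMr ?exprn_gt0//; last by lra.
rewrite ptau.
have key : N * (1 - c) ^+ 2 <= tau ^+ 2.
  have [d1|d2] : (d == 1 \/ 2 <= d)%N by case: (d) d0 => [|[|?]] //; [left|right].
    have -> : N = 3 by rewrite /N (eqP d1).
    have ch : c = 2^-1.
      by rewrite /c /tau /jackson_angle (eqP d1) cos_pi_third.
    by move: s2; rewrite ch; lra.
  have N4 : 4 <= N by rewrite /N ler_nat addn2 !ltnS.
  have p4 : N * tau <= 4.
    by rewrite -ptau; have := pihalf_lt2 R; lra.
  have q1 : (1 - c) ^+ 2 <= tau ^+ 2 * tau ^+ 2 / 4.
    have : (1 - c) ^+ 2 <= (tau ^+ 2 / 2) ^+ 2 by rewrite ler_pXn2r// nnegrE; nra.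
    by lra.
  have q2 : N * tau ^+ 2 <= 4.
    have : (N * tau) * (N * tau) <= 4 * 4 by apply: ler_pM => //; nra.
    nra.
  nra.
have : (3 / 2 / 2 - c + jackson R d 2 / 4) * N = (N * (1 - c) ^+ 2 + (1 - c ^+ 2)) / 2.
  lra.
move=> E.
have -> : (3 / 2 / 2 - c + jackson R d 2 / 4) * N ^+ 3
  = (3 / 2 / 2 - c + jackson R d 2 / 4) * N * N ^+ 2 by ring.
rewrite E [X in _ <= X]exprMn [X in _ <= X]mulrC ler_wpM2r//.
  by apply: exprn_ge0; lra.
lra.
Qed.

(** * The step function and its Chebyshev--Jackson approximation *)

Lemma horner_chebyshev (R : realType) (j : nat) (t : R) :
  (chebyshev R j).[cos t] = cos (j%:R * t).
Proof.
suff : (chebyshev R j).[cos t] = cos (j%:R * t)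
    /\ (chebyshev R j.+1).[cos t] = cos (j.+1%:R * t) by case.
elim: j => [|j [IH0 IH1]].
  by split; rewrite /= ?hornerC ?hornerX ?mul0r ?cos0 ?mul1r.
split => //.
have -> : chebyshev R j.+2 = 2 *: ('X * chebyshev R j.+1) - chebyshev R j by [].
rewrite hornerD hornerN hornerZ hornerM hornerX IH1 IH0.
have -> : j.+2%:R * t = j.+1%:R * t + t by rewrite -[j.+2]addn1 natrD; ring.
have -> : j%:R * t = j.+1%:R * t - t by rewrite -natr1; ring.
by rewrite cosB cosD; ring.
Qed.

(** [sin (j alpha) * cos (j t)] is half the sum of [sin (j (alpha + t))] and
    [sin (j (alpha - t))], so each term of the series is a combination of four
    terms of the primitive of the kernel. *)
Lemma horner_cheb_jackson (R : realType) (alpha beta : R) (d : nat) (t : R) :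
  let G := cosine_primitive d.+2 (jackson_weight R d) in
  pi * (cheb_jackson alpha beta d).[cos t]
    = G (alpha + t) + G (alpha - t) - G (beta + t) - G (beta - t).
Proof.
move=> G.
have pi0 : pi != 0 :> R by rewrite gt_eqF// pi_gt0.
rewrite /G /cosine_primitive.
rewrite -!(big_mkord xpredT
  (fun j => jackson_weight R d j * primitive_cos j%:R _)).
rewrite -big_split/= -!sumrB.
rewrite big_ltn// big_nat_recr//= [jackson_weight R d d.+1]jackson_last.
rewrite !mul0r !(addr0, subr0).
rewrite /cheb_jackson hornerD hornerC horner_sum mulrDr; congr (_ + _).
  rewrite /cheb_coef/jackson_weight/primitive_cos/= eqxx/=.
  by rewrite !mulrA [pi * 2]mulrC mulfK//; field.
rewrite mulr_sumr !big_nat; apply: eq_bigr => j /andP[j1 jd].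
rewrite hornerZ horner_chebyshev /cheb_coef /jackson_weight /primitive_cos.
rewrite pnatr_eq0 gtn_eqF//.
have j0 : j%:R != 0 :> R by rewrite pnatr_eq0 gtn_eqF.
rewrite !mulrDr !mulrN !sinD !sinN !cosN.
move: (pi : R) pi0 => p p0; field.
by rewrite p0 j0.
Qed.

Definition step {R : realType} (alpha beta t : R) : R :=
  if beta < t < alpha then 1
  else if (t == alpha) || (t == beta) then 2^-1 else 0.

(** A nondecreasing [G] with these symmetries lies within [e] of [pi / 2] on
    [[delta, 2 pi - delta]].  The conditions on [t], [alpha] and [beta] put each
    argument in that interval up to sign, or make it 0.  The naive count of four
    errors [e] is halved because monotonicity and the reflection at [pi] fix the
    signs of the errors. *)
Lemma step_approx (R : realType) (G : R -> R) (alpha beta t delta e : R) :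
  {homo G : x y / x <= y} ->
  (forall x, G (- x) = - G x) ->
  (forall x, G (2 * pi - x) = pi - G x) ->
  pi / 2 - G delta <= e ->
  0 < delta -> delta <= beta -> delta <= alpha - beta -> delta <= pi - alpha ->
  0 <= t <= pi ->
  t = alpha \/ delta <= `|t - alpha| ->
  t = beta \/ delta <= `|t - beta| ->
  `|pi * step alpha beta t
     - (G (alpha + t) + G (alpha - t) - G (beta + t) - G (beta - t))| <= 2 * e.
Proof.
move=> Ghomo Godd Grefl hd d0 db dab da /andP[t0 tpi] ta tb.
have lo x : delta <= x -> pi / 2 - e <= G x.
  by move=> /Ghomo; lra.
have hi x : x <= 2 * pi - delta -> G x <= pi / 2 + e.
  by move=> /Ghomo; rewrite Grefl; lra.
have G0 : G 0 = 0 by have := Godd 0; rewrite oppr0; lra.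
have e1 := Godd (t - alpha); rewrite opprB in e1.
have e2 := Godd (t - beta); rewrite opprB in e2.
have half x : x <= pi -> G x <= pi / 2.
  move=> xpi; have := Grefl x; have : G x <= G (2 * pi - x) by apply: Ghomo; lra.
  lra.
have a1 : G (beta + t) <= G (alpha + t) by apply: Ghomo; lra.
have a2 : pi / 2 - e <= G (beta + t) by apply: lo; lra.
have a3 : G (alpha + t) <= pi / 2 + e by apply: hi; lra.
have ba : beta < alpha by lra.
rewrite /step ler_norml.
case: ta => [ta|].
  move: e1 e2 a1 a2 a3; rewrite ta ltxx andbF eqxx/= subrr G0 => e1 e2 a1 a2 a3.
  have b1 : pi / 2 - e <= G (alpha - beta) by apply: lo; lra.
  have b2 : G (alpha - beta) <= pi / 2 by apply: half; lra.
  by apply/andP; split; lra.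
case: tb => [tb|].
  move: e1 e2 a1 a2 a3; rewrite tb ltxx eqxx orbT/= subrr G0 => e1 e2 a1 a2 a3 _.
  have b1 : pi / 2 - e <= G (alpha - beta) by apply: lo; lra.
  have b2 : G (alpha - beta) <= pi / 2 by apply: half; lra.
  by apply/andP; split; lra.
have [tb|tb|->] := ltgtP t beta; last by rewrite subrr normr0; lra.
  have ta : t < alpha by lra.
  rewrite lt_eqF//= !ltr0_norm ?subr_lt0// => d1 d2.
  have b1 : pi / 2 - e <= G (beta - t) by apply: lo; lra.
  have b2 : G (beta - t) <= G (alpha - t) by apply: Ghomo; lra.
  have b3 : G (alpha - t) <= pi - G (alpha + t) by rewrite -Grefl; apply: Ghomo; lra.
  by apply/andP; split; lra.
rewrite gtr0_norm ?subr_gt0// => d1.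
have [ta|ta|->] := ltgtP t alpha; last by rewrite subrr normr0; lra.
  rewrite ltr0_norm ?subr_lt0//= => d2.
  have b1 : pi / 2 - e <= G (t - beta) by apply: lo; lra.
  have b2 : G (t - beta) <= pi / 2 by apply: half; lra.
  have b3 : pi / 2 - e <= G (alpha - t) by apply: lo; lra.
  have b4 : G (alpha - t) <= pi / 2 by apply: half; lra.
  by apply/andP; split; lra.
rewrite gtr0_norm ?subr_gt0//= => d2.
have b1 : pi / 2 - e <= G (t - alpha) by apply: lo; lra.
have b2 : G (t - alpha) <= G (t - beta) by apply: Ghomo; lra.
have b3 : G (t - beta) <= G (beta + t) by apply: Ghomo; lra.
by apply/andP; split; lra.
Qed.

(** The factor [delta ^ 4] comes from [(1 - cos delta)^2], the weight in
    the tail estimate. *)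
Lemma cheb_jackson_step_le (R : realType) (alpha beta t delta : R) (d : nat) :
  (0 < d)%N ->
  0 < delta -> delta <= beta -> delta <= alpha - beta -> delta <= pi - alpha ->
  0 <= t <= pi ->
  t = alpha \/ delta <= `|t - alpha| ->
  t = beta \/ delta <= `|t - beta| ->
  `|step alpha beta t - (cheb_jackson alpha beta d).[cos t]|
    <= pi ^+ 6 / (2 * (d + 2)%:R ^+ 3 * delta ^+ 4).
Proof.
case: d => // d d_gt0 d0 db dab da t0pi ta tb.
have pi0 := pi_gt0 R.
set w := jackson_weight R d.+1; set G := cosine_primitive d.+3 w.
have K0 : forall u, 0 <= cospoly d.+3 w u by exact: jackson_kernel_ge0.
have w0 : w 0%N = 2^-1 by [].
have Gpi : G pi = pi / 2 by rewrite /G cosine_primitive_pi w0.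
have Grefl x : G (2 * pi - x) = pi - G x.
  by rewrite /G cosine_primitive_reflect w0 mulrAC mulfV ?mul1r// pnatr_eq0.
pose q := 1 - cos delta.
have dpi : 0 <= delta <= pi by lra.
have q_ge : 2 * delta ^+ 2 / pi ^+ 2 <= q by exact: one_sub_cos_ge.
have q_low : 0 < 2 * delta ^+ 2 / pi ^+ 2.
  by rewrite divr_gt0 ?mulr_gt0 ?exprn_gt0.
have q0 : 0 < q by exact: lt_le_trans q_ge.
pose e := pi * (pi ^+ 2 / (d.+1 + 2)%:R ^+ 3) / q ^+ 2.
have tail : pi / 2 - G delta <= e.
  rewrite ler_pdivlMr ?exprn_gt0// mulrC -Gpi.
  apply: le_trans (cosine_tail K0 dpi) _.
  by rewrite ler_pM2l//; exact: jackson_moment_le.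
have := step_approx (cosine_primitive_homo K0) (cosine_primitiveN _ _) Grefl
  tail d0 db dab da t0pi ta tb.
rewrite -/G -horner_cheb_jackson -mulrBr normrM gtr0_norm// mulrC -ler_pdivlMr//.
move=> /le_trans; apply.
have qq : (2 * delta ^+ 2 / pi ^+ 2) ^+ 2 <= q ^+ 2.
  by rewrite ler_pXn2r// nnegrE ltW.
have N0 : 0 < (d.+1 + 2)%:R :> R by rewrite ltr0n.
have -> : 2 * e / pi = 2 * (pi ^+ 2 / (d.+1 + 2)%:R ^+ 3) / q ^+ 2.
  rewrite /e; move: (pi : R) pi0 (d.+1 + 2)%:R N0 q0 => p p0 N N0 q0.
  by field; rewrite !gt_eqF.
have -> : pi ^+ 6 / (2 * (d.+1 + 2)%:R ^+ 3 * delta ^+ 4)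
    = 2 * (pi ^+ 2 / (d.+1 + 2)%:R ^+ 3) / (2 * delta ^+ 2 / pi ^+ 2) ^+ 2.
  move: (pi : R) pi0 (d.+1 + 2)%:R N0 => p p0 N N0.
  by field; rewrite !gt_eqF.
rewrite ler_pM2l; last by rewrite mulr_gt0// divr_gt0// exprn_gt0.
by rewrite lef_pV2// posrE exprn_gt0.
Qed.

(** * Matrices diagonal in an orthonormal basis *)

Section SpectralNorm.
Variable R : realType.

Lemma norm2E n (x : 'cV[R]_n) : norm2 x = Num.sqrt ((x^T *m x) 0 0).
Proof.
by rewrite /norm2 mxE; congr Num.sqrt; apply: eq_bigr => i _; rewrite mxE expr2.
Qed.

Lemma norm2_isometry m n (W : 'M[R]_(m, n)) (x : 'cV[R]_n) :
  W^T *m W = 1%:M -> norm2 (W *m x) = norm2 x.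
Proof. by move=> WW; rewrite !norm2E trmx_mul mulmxA -(mulmxA x^T) WW mulmx1. Qed.

Lemma norm2_delta n (i : 'I_n) : norm2 (delta_mx i 0 : 'cV[R]_n) = 1.
Proof.
rewrite /norm2 (bigD1 i)//= mxE !eqxx expr1n big1 ?addr0 ?sqrtr1// => j ji.
by rewrite mxE (negPf ji) expr0n.
Qed.

Lemma norm2Z n (c : R) (x : 'cV[R]_n) : norm2 (c *: x) = `|c| * norm2 x.
Proof.
rewrite /norm2 -sqrtr_sqr -sqrtrM ?sqr_ge0// mulr_sumr; congr Num.sqrt.
by apply: eq_bigr => i _; rewrite mxE exprMn.
Qed.

Lemma norm2_diag_le n (d : 'rV[R]_n) (e : R) (x : 'cV[R]_n) :
  0 <= e -> (forall i, `|d 0 i| <= e) -> norm2 (diag_mx d *m x) <= e * norm2 x.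
Proof.
move=> e0 de; rewrite /norm2.
rewrite -[e](ger0_norm e0) -sqrtr_sqr -sqrtrM ?sqr_ge0// ler_wsqrtr// mulr_sumr.
apply: ler_sum => i _; rewrite mul_diag_mx mxE exprMn ler_wpM2r ?sqr_ge0//.
by rewrite -real_normK ?num_real// ler_pXn2r// nnegrE.
Qed.

Variables (m n : nat) (W : 'M[R]_(m, n)) (V : 'M[R]_n) (d : 'rV[R]_n).
Hypotheses (WW : W^T *m W = 1%:M) (VV : V^T *m V = 1%:M).

Let image_norm x : norm2 (W *m diag_mx d *m V^T *m x) = norm2 (diag_mx d *m (V^T *m x)).
Proof. by rewrite -!mulmxA norm2_isometry. Qed.

Let norm2_trV x : norm2 (V^T *m x) = norm2 x.
Proof. by rewrite norm2_isometry// trmxK mulmx1C. Qed.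

Let ub e : 0 <= e -> (forall i, `|d 0 i| <= e) ->
  ubound [set norm2 (W *m diag_mx d *m V^T *m x) | x in [set x | norm2 x <= 1]] e.
Proof.
move=> e0 de _ [x /= x1 <-]; rewrite image_norm.
apply: le_trans (norm2_diag_le _ e0 de) _.
by rewrite norm2_trV -[leRHS]mulr1 ler_wpM2l.
Qed.

Lemma spectral_norm_le e : 0 <= e -> (forall i, `|d 0 i| <= e) ->
  spectral_norm (W *m diag_mx d *m V^T) <= e.
Proof.
move=> e0 de; apply: ge_sup; last exact: ub.
exists (norm2 (W *m diag_mx d *m V^T *m 0)), 0 => //=.
by rewrite /norm2 big1 ?sqrtr0// => i _; rewrite mxE expr0n.
Qed.

(** The [i]-th column of [V] is a unit vector that is stretched by
    [`|d 0 i|]. *)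
Lemma spectral_norm_ge i : `|d 0 i| <= spectral_norm (W *m diag_mx d *m V^T).
Proof.
apply: ub_le_sup.
  exists (\sum_j `|d 0 j|); apply: ub; first by apply: sumr_ge0.
  by move=> j; rewrite (bigD1 j)//= lerDl sumr_ge0.
exists (V *m delta_mx i 0) => /=.
  by rewrite norm2_isometry// norm2_delta.
rewrite image_norm (mulmxA V^T) VV mul1mx.
have -> : diag_mx d *m delta_mx i 0 = d 0 i *: delta_mx i 0 :> 'cV_n.
  apply/colP => j; rewrite mul_diag_mx !mxE.
  by case: (eqVneq j i) => [->|_]//=; rewrite !mulr0.
by rewrite norm2Z norm2_delta mulr1.
Qed.

End SpectralNorm.

Lemma mxtrace_conj_diag (R : realType) (n : nat) (V : 'M[R]_n) (d : 'rV[R]_n) :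
  V^T *m V = 1%:M -> \tr (V *m diag_mx d *m V^T) = \sum_i d 0 i.
Proof. by move=> VV; rewrite mxtrace_mulC mulmxA VV mul1mx mxtrace_diag. Qed.

Lemma norm_trace_le (R : realType) (n : nat) (V : 'M[R]_n) (d : 'rV[R]_n) :
  V^T *m V = 1%:M ->
  `|\tr (V *m diag_mx d *m V^T)| <= n%:R * spectral_norm (V *m diag_mx d *m V^T).
Proof.
move=> VV; rewrite mxtrace_conj_diag//.
apply: le_trans (ler_norm_sum _ _ _) _.
apply: (@le_trans _ _ (\sum_(i < n) spectral_norm (V *m diag_mx d *m V^T))).
  by apply: ler_sum => i _; exact: spectral_norm_ge.
by rewrite sumr_const card_ord mulr_natl.
Qed.

Lemma horner_mx_conj_diag (R : realType) (n : nat) (V : 'M[R]_n.+1)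
    (d : 'rV[R]_n.+1) (p : {poly R}) :
  V^T *m V = 1%:M ->
  horner_mx (V *m diag_mx d *m V^T) p = V *m diag_mx (map_mx (horner p) d) *m V^T.
Proof.
move=> VV.
have Vu : V \in unitmx by have [] := mulmx1_unit VV.
have Vi : V^T = invmx V.
  by rewrite -[LHS]mulmx1 -(mulmxV Vu) mulmxA VV mul1mx.
by rewrite Vi horner_mx_uconj// horner_mx_diag.
Qed.

Lemma cols_of_mul_tr (R : realType) (n : nat) (V : 'M[R]_n) (I : {set 'I_n}) :
  cols_of V I *m (cols_of V I)^T
  = V *m diag_mx (\row_i (i \in I)%:R) *m V^T.
Proof.
apply/matrixP => i j; rewrite !mxE.
under eq_bigr => k _ do rewrite !mxE.
rewrite -(@big_enum_val _ _ _ _ (mem I) (fun k => V i k * V j k)) /=.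
rewrite big_mkcond; apply: eq_bigr => k _.
rewrite mul_mx_diag !mxE; case: (k \in I); first by rewrite mulr1.
by rewrite mulr0 mul0r.
Qed.

Lemma spectral_projectorE (R : realType) (n : nat) (s : 'rV[R]_n) (V : 'M[R]_n)
    (a b : R) :
  spectral_projector s V a b
  = V *m diag_mx (\row_i
      if a ^+ 2 < s 0 i ^+ 2 < b ^+ 2 then 1
      else if (s 0 i ^+ 2 == a ^+ 2) || (s 0 i ^+ 2 == b ^+ 2) then 2^-1
      else 0) *m V^T.
Proof.
rewrite /spectral_projector !cols_of_mul_tr.
rewrite scalemxAl scalemxAr -mulmxDl -mulmxDr; congr (_ *m _ *m _).
rewrite -linearZ -linearD /=; congr diag_mx.
apply/rowP => i; rewrite !mxE !inE.
case: ifP => [/andP[si_gt si_lt]|_].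
  by rewrite gt_eqF// lt_eqF//= mulr0 addr0.
by case: ifP; rewrite ?mulr1 ?mulr0 add0r.
Qed.

(** * Singular values as angles *)

Section Angle.
Variables (R : realType) (smin N : R).
Hypotheses (smin_ge0 : 0 <= smin) (smin_lt : smin < N).
Let l := lmap N smin.

Lemma horner_lmap x :
  l.[x] = (2 * x - (N ^+ 2 + smin ^+ 2)) / (N ^+ 2 - smin ^+ 2).
Proof. by rewrite /l /lmap !hornerE mulrC. Qed.

Let den_gt0 : 0 < N ^+ 2 - smin ^+ 2.
Proof.
have N0 : 0 <= N := le_trans smin_ge0 (ltW smin_lt).
by rewrite subr_gt0 ltr_pXn2r// nnegrE.
Qed.

Lemma lmap_itv x : smin <= x <= N -> -1 <= l.[x ^+ 2] <= 1.
Proof.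
move=> /andP[x1 x2]; rewrite horner_lmap.
have x0 : 0 <= x by exact: le_trans x1.
have q1 : smin ^+ 2 <= x ^+ 2 by rewrite ler_pXn2r// nnegrE.
have q2 : x ^+ 2 <= N ^+ 2 by rewrite ler_pXn2r// nnegrE// (le_trans x0).
by rewrite ler_pdivlMr// ler_pdivrMr//; apply/andP; split; lra.
Qed.

Lemma cos_angle x : smin <= x <= N -> cos (angle l x) = l.[x ^+ 2].
Proof. by move=> /lmap_itv xi; rewrite acosK// in_itv. Qed.

Lemma angle_itv x : smin <= x <= N -> 0 <= angle l x <= pi.
Proof. by move=> /lmap_itv xi; rewrite acos_ge0// acos_lepi. Qed.

Lemma angle_lt x y : smin <= x <= N -> smin <= y <= N ->
  (angle l x < angle l y) = (y < x).
Proof.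
move=> xi yi.
rewrite -ltr_cos ?in_itv/= ?angle_itv// !cos_angle// !horner_lmap.
rewrite ltr_pM2r ?invr_gt0// ltrD2r ltr_pM2l//.
by rewrite ltr_pXn2r// nnegrE (le_trans smin_ge0)//; [case/andP: yi|case/andP: xi].
Qed.

Lemma angle_le x y : smin <= x <= N -> smin <= y <= N ->
  (angle l x <= angle l y) = (y <= x).
Proof. by move=> xi yi; rewrite leNgt angle_lt// -leNgt. Qed.

Lemma angle_eq x y : smin <= x <= N -> smin <= y <= N ->
  (angle l x == angle l y) = (x == y).
Proof. by move=> xi yi; rewrite !eq_le !angle_le// andbC. Qed.

(** [angle] is decreasing, so the two ends of the interval are exchanged. *)
Lemma step_angle a b x : 0 <= a -> a < b ->
  smin <= a <= N -> smin <= b <= N -> smin <= x <= N ->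
  step (angle l a) (angle l b) (angle l x)
  = if a ^+ 2 < x ^+ 2 < b ^+ 2 then 1
    else if (x ^+ 2 == a ^+ 2) || (x ^+ 2 == b ^+ 2) then 2^-1 else 0.
Proof.
move=> a0 ab ai bi xi.
have x0 : 0 <= x by apply: le_trans smin_ge0 _; case/andP: xi.
have b0 : 0 <= b by lra.
by rewrite /step !angle_lt// !angle_eq// !eqrXn2// !ltr_pXn2r// andbC.
Qed.

End Angle.

(** * Error of the approximate projector *)

Lemma min4_le (R : realDomainType) (w x y z : R) :
  let m := Num.min (Num.min w x) (Num.min y z) in
  [/\ m <= w, m <= x, m <= y & m <= z].
Proof. by split; rewrite !ge_min lexx ?orbT. Qed.

Lemma min4_gt0 (R : realDomainType) (w x y z : R) :
  0 < w -> 0 < x -> 0 < y -> 0 < z ->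
  0 < Num.min (Num.min w x) (Num.min y z).
Proof. by move=> w0 x0 y0 z0; rewrite !lt_min w0 x0 y0 z0. Qed.

(* The number of columns is written n.+1: it is positive, since A has a
   smallest singular value. *)
Theorem theorem4p2 (R : realType) (m n : nat) (A : 'M[R]_(m, n.+1))
  (hmn : (n.+1 <= m)%N)
  (U : 'M[R]_(m, n.+1)) (s : 'rV[R]_n.+1) (V : 'M[R]_n.+1)
  (hsvd : is_svd A U s V)
  (smin : R) (hsmin : is_least (range (s 0)) smin)
  (a b : R) (hab : a < b)
  (hsub : smin <= a /\ b <= spectral_norm A)
  (sil sir sol sor : R)
  (hsil : is_least (range (s 0) `&` [set x | a < x < b]) sil)
  (hsir : is_greatest (range (s 0) `&` [set x | a < x < b]) sir)
  (hsol : is_greatest (range (s 0) `&` [set x | x < a]) sol)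
  (hsor : is_least (range (s 0) `&` [set x | b < x]) sor)
  (d : nat) (hd : (0 < d)%N) :
  let S := A^T *m A in
  let l := lmap (spectral_norm A) smin in
  let PS := spectral_projector s V a b in
  let P := approx_projector S l a b d in
  `|\tr PS - \tr P| <= n.+1%:R * spectral_norm (PS - P) /\
  n.+1%:R * spectral_norm (PS - P) <=
    n.+1%:R * pi ^+ 6
      / (2 * (d + 2)%:R ^+ 3 * Delta_min l a b sil sir sol sor ^+ 4).
Proof.
move=> S l PS P.
case: hsvd => UU VV s_ge0 AE.
case: hsub => smin_a b_N.
case: hsmin => -[i0 _ si0] smin_lb.
have smin0 : 0 <= smin by rewrite -si0.
have sN i : smin <= s 0 i <= spectral_norm A.
  apply/andP; split; first by apply: smin_lb; exists i.
  have := spectral_norm_ge s UU VV i.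
  by rewrite -AE ger0_norm.
have smin_N : smin < spectral_norm A by lra.
have ai : smin <= a <= spectral_norm A by lra.
have bi : smin <= b <= spectral_norm A by lra.
have a0 : 0 <= a by lra.
case: hsil => -[[i1 _ <-] /= /andP[il_a il_b]] il_lb.
case: hsir => -[[i2 _ <-] /= /andP[ir_a ir_b]] ir_ub.
case: hsol => -[[i3 _ <-] /= ol_a] ol_ub.
case: hsor => -[[i4 _ <-] /= or_b] or_lb.
(* The inner extremes [sil] and [sir] also bound the singular values beyond the
   opposite end of the interval, so that an angle other than [alpha] is at
   least as far from [alpha] as those of [sil] and [sol] on its side, and
   likewise for [beta]. *)
have il_le i : a < s 0 i -> s 0 i1 <= s 0 i.
  move=> asi; have [sib|bsi] := ltP (s 0 i) b; last by lra.
  by apply: il_lb; split; [exists i|rewrite /= asi].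
have ir_ge i : s 0 i < b -> s 0 i <= s 0 i2.
  move=> sib; have [asi|sia] := ltP a (s 0 i); last by lra.
  by apply: ir_ub; split; [exists i|rewrite /= asi].
have ol_ge i : s 0 i < a -> s 0 i <= s 0 i3.
  by move=> sia; apply: ol_ub; split; [exists i|].
have or_le i : b < s 0 i -> s 0 i4 <= s 0 i.
  by move=> bsi; apply: or_lb; split; [exists i|].
have lt_angle := angle_lt smin0 smin_N.
have le_angle := angle_le smin0 smin_N.
have itv_angle := angle_itv smin0 smin_N.
set alpha := angle l a; set beta := angle l b.
pose t i := angle l (s 0 i).
have t1a : t i1 < alpha by rewrite lt_angle.
have bt1 : beta < t i1 by rewrite lt_angle.
have t2b : beta < t i2 by rewrite lt_angle.
have t3a : alpha < t i3 by rewrite lt_angle.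
have t4b : t i4 < beta by rewrite lt_angle.
set delta := Delta_min _ _ _ _ _ _ _.
have [] := min4_le `|t i1 - alpha| `|t i2 - beta| `|t i3 - alpha| `|t i4 - beta|.
rewrite -[Num.min _ _]/delta.
rewrite ltr0_norm ?subr_lt0// gtr0_norm ?subr_gt0// gtr0_norm ?subr_gt0//.
rewrite ltr0_norm ?subr_lt0// => dil dir dol dor.
have d0 : 0 < delta.
  by apply: min4_gt0; rewrite normr_gt0 subr_eq0 neq_lt ?t1a ?t2b ?t3a ?t4b ?orbT.
have t_itv i : 0 <= t i <= pi by exact: itv_angle.
have t_alpha i : t i = alpha \/ delta <= `|t i - alpha|.
  have [sia|asi|sia] := ltgtP (s 0 i) a; last by left; rewrite /t sia.
  - right; have : t i3 <= t i by rewrite le_angle// ol_ge.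
    by move=> t3; rewrite gtr0_norm; lra.
  - right; have : t i <= t i1 by rewrite le_angle// il_le.
    by move=> t1; rewrite ltr0_norm; lra.
have t_beta i : t i = beta \/ delta <= `|t i - beta|.
  have [sib|bsi|sib] := ltgtP (s 0 i) b; last by left; rewrite /t sib.
  - right; have : t i2 <= t i by rewrite le_angle// ir_ge.
    by move=> t2; rewrite gtr0_norm; lra.
  - right; have : t i <= t i4 by rewrite le_angle// or_le.
    by move=> t4; rewrite ltr0_norm; lra.
have /andP[t3_ge0 t3_le] := t_itv i3.
have /andP[t4_ge0 t4_le] := t_itv i4.
pose psi := cheb_jackson alpha beta d.
pose err : 'rV[R]_n.+1 := \row_i (step alpha beta (t i) - psi.[cos (t i)]).
have SE : S = V *m diag_mx (\row_i s 0 i ^+ 2) *m V^T.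
  rewrite /S AE !trmx_mul trmxK tr_diag_mx !mulmxA.
  rewrite -(mulmxA _ U^T U) UU mulmx1 -(mulmxA V (diag_mx s)) mulmx_diag.
  by congr (_ *m diag_mx _ *m _); apply/rowP => i; rewrite !mxE expr2.
have PE : PS - P = V *m diag_mx err *m V^T.
  rewrite /PS /P spectral_projectorE /approx_projector SE !horner_mx_conj_diag//.
  rewrite -mulmxBl -mulmxBr -linearB /=; congr (_ *m diag_mx _ *m _).
  apply/rowP => i; rewrite !mxE /t step_angle// cos_angle//.
have err_le i : `|err 0 i| <= pi ^+ 6 / (2 * (d + 2)%:R ^+ 3 * delta ^+ 4).
  by rewrite mxE; apply: cheb_jackson_step_le => //; lra.
split; first by rewrite -raddfB PE norm_trace_le.
rewrite -mulrA ler_pM2l ?ltr0n// PE spectral_norm_le//.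
exact: le_trans (err_le ord0).
Qed.
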